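(* The group $\overline{\overline\Gamma}=\langle a,t\rangle$ is a just-infinite fractal group, and is a regular branch group over its commutator subgroup $\overline{\overline\Gamma}'$.
   Context: Let $\Sigma=\{0,1,2\}$ and let $\mathcal T_3=\Sigma^*$ be the ternary rooted tree; automorphisms act on the left on finite words. For a letter $x$ let $\overline x=x+1\bmod 3$ and $\overline{\overline x}=x+2\bmod 3$. The automorphism $a$ is given by $a(x\sigma)=\overline x\sigma$. The automorphism $t$ is defined recursively (fixing all first-level vertices) by $t(0x\sigma)=0\overline x\sigma$, $t(1x\sigma)=1\overline{\overline x}\sigma$, $t(2\sigma)=2t(\sigma)$. $\overline{\overline\Gamma}$ is the subgroup of $\operatorname{Aut}(\mathcal T_3)$ generated by $a$ and $t$ (the bars are just part of the name). For $G<\operatorname{Aut}(\mathcal T_3)$: $\operatorname{Stab}_G(\sigma)$ is the stabilizer of the vertex $\sigma$, $\operatorname{Stab}_G(n)=\bigcap_{\sigma\in\Sigma^n}\operatorname{Stab}_G(\sigma)$. If $g$ fixes $\sigma$, $g_{|\sigma}$ is defined by $g(\sigma\tau)=\sigma\,g_{|\sigma}(\tau)$, and $\phi(h)=(h_{|0},h_{|1},h_{|2})$ for $h$ fixing the first level. $G$ is just-infinite if it is infinite and all its quotients by non-trivial normal subgroups are finite; fractal if $\operatorname{Stab}_G(\sigma)_{|\sigma}=G$ for every vertex $\sigma$ (identifying the subtree at $\sigma$ with the whole tree); regular branch over $K$ if $K<\operatorname{Stab}_G(1)$ is a finite-index normal subgroup of $G$ with $K\times K\times K<\phi(K)$. 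*)

(* Defs.v *)
From HB Require Import structures.
From mathcomp Require Import all_boot.
From mathcomp Require Import boolp classical_sets cardinality.

Set Implicit Arguments.
Unset Strict Implicit.
Unset Printing Implicit Defensive.

Local Open Scope group_scope.
Local Open Scope classical_set_scope.

Section GroupNotions.
Variable gT : groupType.
Implicit Types (A G K N : set gT).

Definition is_subgroup G : Prop := group_closed (mem G).

Definition generated A : set gT := smallest is_subgroup A.

Definition is_normal N G : Prop :=
  [/\ is_subgroup N, N `<=` G & forall x y, N x -> G y -> N (x ^ y)].

Definition derived_subgroup G : set gT :=
  generated [set z | exists x y, [/\ G x, G y & z = [~ x, y]]].

Definition left_cosets G N : set (set gT) :=
  [set [set x * y | y in N] | x in G].

Definition just_infinite G : Prop :=
  infinite_set G /\
  forall N, is_normal N G -> N <> [set 1] -> finite_set (left_cosets G N).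

End GroupNotions.

(* The vertices of the ternary rooted tree are the finite words over
   {0, 1, 2}; an automorphism is a length- and prefix-preserving bijection. *)
Notation letter := 'I_3.
Notation word := (seq 'I_3).

Record tree_aut := TreeAut {
  aut_fun :> word -> word;
  aut_inv : word -> word;
  aut_funK : cancel aut_fun aut_inv;
  aut_invK : cancel aut_inv aut_fun;
  aut_size : forall u, size (aut_fun u) = size u;
  aut_prefix : forall u v, prefix u v -> prefix (aut_fun u) (aut_fun v)
}.

HB.instance Definition _ := gen_eqMixin tree_aut.
HB.instance Definition _ := gen_choiceMixin tree_aut.

Lemma tree_autP (g h : tree_aut) : g =1 h -> g = h.
Proof.
case: g h => [f f' K K' S P] [h h' L L' T Q] /= fh.
have e : f = h by apply: funext.
subst h; have e : f' = h'.
  by apply: funext => w; rewrite -{1}(L' w) K.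
by subst h'; congr TreeAut; apply: Prop_irrelevance.
Qed.

Lemma aut_inv_size (g : tree_aut) w : size (aut_inv g w) = size w.
Proof. by rewrite -(aut_size g) aut_invK. Qed.

Lemma aut_inv_prefix (g : tree_aut) u v :
  prefix u v -> prefix (aut_inv g u) (aut_inv g v).
Proof.
move=> uv; set v' := aut_inv g v.
have le_uv : size u <= size v' by rewrite aut_inv_size size_prefix.
have : prefix (g (take (size u) v')) v.
  by rewrite -[X in prefix _ X](aut_invK g v) aut_prefix // prefix_take.
rewrite prefixE aut_size size_takel // => /eqP e.
move: uv; rewrite prefixE e => /eqP <-.
by rewrite aut_funK prefix_take.
Qed.

Definition aut_one : tree_aut :=
  @TreeAut id id (fun=> erefl) (fun=> erefl) (fun=> erefl) (fun _ _ => id).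

Definition aut_invg (g : tree_aut) : tree_aut :=
  TreeAut (aut_invK g) (aut_funK g) (aut_inv_size g) (@aut_inv_prefix g).

Section Composition.
Variables g h : tree_aut.

Fact aut_mul_size w : size ((g \o h) w) = size w.
Proof. by rewrite /= !aut_size. Qed.

Fact aut_mul_prefix u v : prefix u v -> prefix ((g \o h) u) ((g \o h) v).
Proof. by move=> uv; do 2!apply: aut_prefix. Qed.

(* Left action: (g * h) w = g (h w). *)
Definition aut_mul : tree_aut :=
  TreeAut (can_comp (aut_funK g) (aut_funK h))
          (can_comp (aut_invK h) (aut_invK g)) aut_mul_size aut_mul_prefix.

End Composition.

Fact aut_mulA : associative aut_mul.
Proof. by move=> f g h; apply: tree_autP. Qed.
Fact aut_mul1 : left_id aut_one aut_mul.
Proof. by move=> g; apply: tree_autP. Qed.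
Fact aut_mul1r : right_id aut_one aut_mul.
Proof. by move=> g; apply: tree_autP. Qed.
Fact aut_mulV : left_inverse aut_one aut_invg aut_mul.
Proof. by move=> g; apply: tree_autP => w /=; rewrite aut_funK. Qed.
Fact aut_mulVr : right_inverse aut_one aut_invg aut_mul.
Proof. by move=> g; apply: tree_autP => w /=; rewrite aut_invK. Qed.

HB.instance Definition _ := isGroup.Build tree_aut
  aut_mulA aut_mul1 aut_mul1r aut_mulV aut_mulVr.

Section Restriction.
Variables (s : word) (g : tree_aut).

Let res_fun w := drop (size s) (g (s ++ w)).
Let res_inv w := drop (size s) (aut_inv g (g s ++ w)).

Fact restr_fun_cat w : g (s ++ w) = g s ++ res_fun w.
Proof.
have := aut_prefix g (prefix_prefix s w).
by rewrite prefixE aut_size => /eqP e; rewrite -[RHS](congr1 (cat^~ _) e) cat_take_drop.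
Qed.

Fact restr_inv_cat w : aut_inv g (g s ++ w) = s ++ res_inv w.
Proof.
have := aut_inv_prefix g (prefix_prefix (g s) w).
by rewrite aut_funK prefixE => /eqP e; rewrite -[RHS](congr1 (cat^~ _) e) cat_take_drop.
Qed.

Fact restr_funK : cancel res_fun res_inv.
Proof.
by move=> w; rewrite /res_inv -restr_fun_cat aut_funK drop_size_cat.
Qed.

Fact restr_invK : cancel res_inv res_fun.
Proof.
by move=> w; rewrite /res_fun -restr_inv_cat aut_invK drop_size_cat ?aut_size.
Qed.

Fact restr_size w : size (res_fun w) = size w.
Proof. by rewrite size_drop aut_size size_cat addKn. Qed.

Fact restr_prefix u v : prefix u v -> prefix (res_fun u) (res_fun v).
Proof.
move=> uv; have : prefix (g (s ++ u)) (g (s ++ v)).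
  by apply: aut_prefix; rewrite prefix_catr // eqxx.
by rewrite !restr_fun_cat prefix_catr // eqxx.
Qed.

(* g_{|s}.  It is total: for any g one has g (s ++ w) = g s ++ restr s g w;
   it is only used when g fixes s, where restrE characterises it. *)
Definition restr : tree_aut :=
  TreeAut restr_funK restr_invK restr_size restr_prefix.

Lemma restrE : g s = s -> forall w, g (s ++ w) = s ++ restr w.
Proof. by move=> gs w; rewrite restr_fun_cat gs. Qed.

End Restriction.

Section TreeGroups.
Implicit Types (G K : set tree_aut).

Definition vertex_stab G (s : word) : set tree_aut :=
  [set g | G g /\ g s = s].

Definition level_stab G (n : nat) : set tree_aut :=
  \bigcap_(s in [set s : word | size s = n]) vertex_stab G s.

Definition phi (h : tree_aut) : tree_aut * tree_aut * tree_aut :=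
  (restr [:: inord 0] h, restr [:: inord 1] h, restr [:: inord 2] h).

Definition fractal G : Prop :=
  forall s : word, restr s @` vertex_stab G s = G.

Definition regular_branch_over G K : Prop :=
  [/\ is_normal K G, K `<=` level_stab G 1, finite_set (left_cosets G K)
    & K `*` K `*` K `<=` phi @` K].

End TreeGroups.

(* A map of order dividing 3 whose square is then its inverse. *)
Section OrderThree.
Variable f : word -> word.
Hypothesis f3 : forall w, f (f (f w)) = w.
Hypothesis f_size : forall w, size (f w) = size w.
Hypothesis f_prefix : forall u v, prefix u v -> prefix (f u) (f v).
Definition aut_of_order3 : tree_aut :=
  @TreeAut f (f \o f) f3 f3 f_size f_prefix.
End OrderThree.

(* bar x = x + 1 mod 3. *)
Notation bar := (@ordS 3).

Fact bar3 x : bar (bar (bar x)) = x.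
Proof. by apply: val_inj; case: x => -[|[|[]]]. Qed.

Definition a_fun (w : word) : word :=
  if w is x :: s then bar x :: s else [::].

Fixpoint t_fun (w : word) : word :=
  if w is x :: w' then
    match val x, w' with
    | 0, y :: s => x :: bar y :: s
    | 1, y :: s => x :: bar (bar y) :: s
    | 2, _ => x :: t_fun w'
    | _, _ => w
    end
  else [::].

Fact a_fun3 w : a_fun (a_fun (a_fun w)) = w.
Proof. by case: w => //= x s; rewrite bar3. Qed.

Fact a_size w : size (a_fun w) = size w.
Proof. by case: w. Qed.

Fact a_prefix u v : prefix u v -> prefix (a_fun u) (a_fun v).
Proof. by case: u v => [|x u] [|y v] //= /andP[/eqP-> ->]; rewrite eqxx. Qed.

Fact t_fun3 w : t_fun (t_fun (t_fun w)) = w.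
Proof.
elim: w => //= -[[|[|[|//]]] lt_x] w IH /=.
- by case: w {IH} => //= y s; rewrite bar3.
- by case: w {IH} => //= y s; rewrite !bar3.
- by rewrite IH.
Qed.

Fact t_size w : size (t_fun w) = size w.
Proof.
by elim: w => //= -[[|[|[|//]]] lt_x] w IH /=; rewrite ?IH //; case: w {IH}.
Qed.

Fact t_prefix u v : prefix u v -> prefix (t_fun u) (t_fun v).
Proof.
elim: u v => [|x u IH] v; first by rewrite !prefix0s.
case: v => [|y v] //= /andP[/eqP<- {y}].
case: x => [[|[|[|//]]] lt_x] /= uv; last exact: IH.
- case: u v uv {IH} => [|y u] [|z v] //=.
  by move=> /andP[/eqP-> ->]; rewrite eqxx.
- case: u v uv {IH} => [|y u] [|z v] //=.
  by move=> /andP[/eqP-> ->]; rewrite eqxx.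
Qed.

Definition aut_a : tree_aut := aut_of_order3 a_fun3 a_size a_prefix.
Definition aut_t : tree_aut := aut_of_order3 t_fun3 t_size t_prefix.

Definition GammaBB : set tree_aut := generated [set aut_a; aut_t].

(* Main.v *)
Require Import Defs.
From mathcomp Require Import all_boot boolp classical_sets cardinality.

Set Implicit Arguments.
Unset Strict Implicit.
Unset Printing Implicit Defensive.

Local Open Scope group_scope.
Local Open Scope classical_set_scope.

(** Write [G] for the group generated by [a] and [t], and [K] for its commutator
    subgroup. Every element of [G] is a power of [a] times an automorphism
    [node f] that fixes the first level and whose three sections [f x] lie in
    [G] (lemma [G_decomp]); conversely every element of [G] is a section, at any
    given letter, of an element of [G] fixing the first level (lemma
    [G_section]). Fractality follows by induction on the vertex, and so does
    the infinity of [G]: taking sections at a letter maps the stabilizer of that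
    letter, a proper subgroup, onto [G].

    Branching rests on the identity [t * t ^ a = (1, a^-1 t, t a)]. The
    commutator of two rotated copies of this element has a single non-trivial
    section, [[~ t a, a^-1 t]], and since [t a] and [a^-1 t] generate [G], the
    normal subgroup that this commutator generates is all of [K]. Hence [K]
    contains a copy [emb x k] of each of its elements [k] at each letter [x].

    For just-infinity, let [N] be a non-trivial normal subgroup, and [g] an
    element of [N] moving the word [w]. The argument only uses that [N] is
    normalized by [G] and contains all commutators [[~ g, k]] with [k] in [K],
    and in this form it is an induction on [w]. If [g] fixes the first level, it
    passes to its section at the first letter of [w] and to the set of all [k]
    with [emb x k] in [N]. If [g] rotates the first level, then [[~ g, emb x k]]
    has two non-trivial sections, both arbitrary in [K]; commuting with the
    rotated copies of [(1, a^-1 t, t a)] kills either of them, so that at each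
    letter [N] contains all commutators of an element of [K] with [a^-1 t] or
    [t a], hence with any element of [G]. Finally, modulo the third term of the
    lower central series [G] has at most 27 elements, and finite index at a
    letter entails finite index in [G] because [G] has finitely many rotations
    and three letters. *)

(** * Subgroups, generation and commutators *)

Section GroupGeneralities.
Variable gT : groupType.
Implicit Types (G H R A : set gT) (g h x y u v : gT).

Lemma subgroupP H :
  is_subgroup H <-> [/\ H 1, forall x y, H x -> H y -> H (x * y)
                     & forall x, H x -> H x^-1].
Proof.
split=> [Hs | [H1 HM HV]].
  split; first by case: Hs => H1 _; rewrite inE in H1.
    by move=> x y Hx Hy; have := group_closedM Hs (mem_set Hx) (mem_set Hy);
      rewrite inE.
  by move=> x Hx; have := group_closedV Hs (mem_set Hx); rewrite inE.
split; first by rewrite inE.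
by move=> x y; rewrite !inE => Hx Hy; apply: HM => //; apply: HV.
Qed.

Lemma subg1 H : is_subgroup H -> H 1.
Proof. by case/subgroupP. Qed.

Lemma subgM H x y : is_subgroup H -> H x -> H y -> H (x * y).
Proof. by case/subgroupP => _ HM _; apply: HM. Qed.

Lemma subgV H x : is_subgroup H -> H x -> H x^-1.
Proof. by case/subgroupP => _ _; apply. Qed.

Lemma subgX H x n : is_subgroup H -> H x -> H (x ^+ n).
Proof.
by move=> Hs Hx; elim: n => [|n IH]; rewrite ?expg0 ?expgS;
  [exact: subg1 | exact: subgM].
Qed.

Lemma subgJ H x y : is_subgroup H -> H x -> H y -> H (x ^ y).
Proof. by move=> Hs Hx Hy; do 2?apply: subgM => //; apply: subgV. Qed.

Lemma subgR H x y : is_subgroup H -> H x -> H y -> H [~ x, y].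
Proof. by move=> Hs Hx Hy; apply: subgM (subgV Hs Hx) (subgJ Hs Hx Hy). Qed.

Lemma gen_subgroup A : is_subgroup (generated A).
Proof.
apply/subgroupP; split=> [H [Hs _] | x y Ax Ay H HA | x Ax H HA].
- exact: subg1.
- by apply: subgM (Ax H HA) (Ay H HA); case: HA.
- by apply: subgV (Ax H HA); case: HA.
Qed.

Lemma expg_mod3 x i : x ^+ 3 = 1 -> x ^+ i = x ^+ (i %% 3).
Proof.
move=> x3; rewrite [in LHS](divn_eq i 3) expgnDr (mulnC _ 3) expgnA x3.
by rewrite expg1n mul1g.
Qed.

(** [R] may lie outside [G]: groups of sections are normalized by [G] without
    being contained in it by definition. *)
Definition normalized G R : Prop :=
  is_subgroup R /\ forall r g, R r -> G g -> R (r ^ g).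

(** The commutator identities for [[~ x * y, h]] and [[~ x^-1, h]] only leave
    conjugates by elements of [G]. *)
Lemma centralizer_mod_subgroup G R h :
  is_subgroup G -> normalized G R -> is_subgroup [set g | G g /\ R [~ g, h]].
Proof.
move=> Gs [Rs RJ]; apply/subgroupP; split=> [|x y [Gx Rx] [Gy Ry]|x [Gx Rx]].
- by rewrite /= comm1g; split; apply: subg1.
- split; first exact: subgM.
  have -> : [~ x * y, h] = [~ x, h] ^ y * [~ y, h].
    by rewrite /commg /conjg !gnorm.
  by apply: subgM => //; apply: RJ.
- have Gx' := subgV Gs Gx; split=> //.
  have -> : [~ x^-1, h] = [~ x, h]^-1 ^ x^-1.
    by rewrite /commg /conjg !gnorm.
  by apply: RJ => //; apply: subgV.
Qed.

Lemma comm_mod_gens_left u v R h :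
    let G := generated [set u; v] in
    normalized G R -> R [~ u, h] -> R [~ v, h] ->
  forall g, G g -> R [~ g, h].
Proof.
move=> G RG Ru Rv g Gg; have Gs : is_subgroup G by apply: gen_subgroup.
have : [set g | G g /\ R [~ g, h]] g; last by case.
apply: Gg; split; first exact: centralizer_mod_subgroup.
by move=> _ [->|->]; split=> //; apply: sub_gen_smallest; [left | right].
Qed.

(** If the generators commute modulo [R], then they are central modulo [R], by a
    first use of [comm_mod_gens_left], and by a second one so is everything. *)
Lemma comm_mod_of_gens u v R :
    let G := generated [set u; v] in
    normalized G R -> R [~ u, v] ->
  forall g h, G g -> G h -> R [~ g, h].
Proof.
move=> G RG Ruv; have Rs := RG.1.
have sym x y : R [~ x, y] -> R [~ y, x].
  by move=> Rxy; rewrite -invgR; apply: subgV.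
have refl x : R [~ x, x] by rewrite commgg; apply: subg1.
have Ru y : G y -> R [~ y, u] by apply: comm_mod_gens_left => //; apply: sym.
have Rv y : G y -> R [~ y, v] by apply: comm_mod_gens_left.
by move=> g h Gg Gh; apply: comm_mod_gens_left Gg => //; apply: sym; auto.
Qed.

Lemma derived_sub G R :
    is_subgroup R -> (forall g h, G g -> G h -> R [~ g, h]) ->
  derived_subgroup G `<=` R.
Proof.
by move=> Rs RG; apply: smallest_sub => // _ [x [y [Gx Gy ->]]]; auto.
Qed.

Lemma comm_derived G g h : G g -> G h -> derived_subgroup G [~ g, h].
Proof. by move=> Gg Gh; apply: sub_gen_smallest; exists g, h. Qed.

Lemma derived_normal G : is_subgroup G -> is_normal (derived_subgroup G) G.
Proof.
move=> Gs; have Ks : is_subgroup (derived_subgroup G) by apply: gen_subgroup.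
have KG : derived_subgroup G `<=` G.
  by apply: derived_sub => // g h; apply: subgR.
split=> // x y Kx Gy.
have -> : x ^ y = x * [~ x, y] by rewrite /commg mulVKg.
by apply: (subgM Ks) => //; apply: comm_derived => //; apply: KG.
Qed.

End GroupGeneralities.

(** * Portraits of depth one *)

(** [node f] is the inverse image of the family of sections [f] under the
    decomposition map [phi]. *)
Section Node.
Variable f : letter -> tree_aut.

Let node_fun (w : word) : word := if w is x :: w' then x :: f x w' else [::].
Let node_inv (w : word) : word :=
  if w is x :: w' then x :: aut_inv (f x) w' else [::].

Fact node_funK : cancel node_fun node_inv.
Proof. by case=> //= x w; rewrite aut_funK. Qed.

Fact node_invK : cancel node_inv node_fun.
Proof. by case=> //= x w; rewrite aut_invK. Qed.

Fact node_size w : size (node_fun w) = size w.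
Proof. by case: w => //= x w; rewrite aut_size. Qed.

Fact node_prefix u v : prefix u v -> prefix (node_fun u) (node_fun v).
Proof.
case: u v => [|x u] [|y v] //= /andP[/eqP-> uv].
by rewrite eqxx /= aut_prefix.
Qed.

Definition node : tree_aut :=
  TreeAut node_funK node_invK node_size node_prefix.

End Node.

(** A copy of [k] acting on the subtree at [x] only. *)
Definition emb (x : letter) (k : tree_aut) : tree_aut :=
  node (fun z => if z == x then k else 1).

Lemma aut_nil (g : tree_aut) : g [::] = [::].
Proof. by apply: size0nil; rewrite aut_size. Qed.

Lemma eq_node f g : f =1 g -> node f = node g.
Proof. by move=> /funext->. Qed.

Lemma nodeM f g : node f * node g = node (fun x => f x * g x).
Proof. by apply: tree_autP; case. Qed.

Lemma node1 : node (fun=> 1) = 1.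
Proof. by apply: tree_autP; case. Qed.

Lemma nodeV f : (node f)^-1 = node (fun x => (f x)^-1).
Proof. by apply: tree_autP; case. Qed.

Lemma nodeJ f g : node f ^ node g = node (fun x => f x ^ g x).
Proof. by rewrite /conjg nodeV !nodeM. Qed.

Lemma nodeR f g : [~ node f, node g] = node (fun x => [~ f x, g x]).
Proof. by rewrite /commg nodeJ nodeV nodeM. Qed.

Lemma restr_node s x f : restr (x :: s) (node f) = restr s (f x).
Proof. by apply: tree_autP. Qed.

Lemma restr_nil g : restr [::] g = g.
Proof. by apply: tree_autP => w /=; rewrite drop0. Qed.

Lemma embM x k l : emb x (k * l) = emb x k * emb x l.
Proof. by rewrite nodeM; apply: eq_node => z; case: eqP; rewrite ?mulg1. Qed.

Lemma embV x k : emb x k^-1 = (emb x k)^-1.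
Proof. by rewrite nodeV; apply: eq_node => z; case: eqP; rewrite ?invg1. Qed.

Lemma emb1 x : emb x 1 = 1.
Proof. by rewrite -[RHS]node1; apply: eq_node => z; case: eqP. Qed.

Lemma embJ x k f : emb x k ^ node f = emb x (k ^ f x).
Proof.
by rewrite nodeJ; apply: eq_node => z; case: eqP => [->|]; rewrite ?conj1g.
Qed.

Lemma comm_node_emb x k f : [~ node f, emb x k] = emb x [~ f x, k].
Proof.
by rewrite nodeR; apply: eq_node => z; case: eqP => [->|]; rewrite ?commg1.
Qed.

Lemma letter_ind (P : letter -> Prop) :
  P (inord 0) -> P (inord 1) -> P (inord 2) -> forall x, P x.
Proof.
move=> P0 P1 P2 x; have : x = inord x by rewrite inord_val.
by case: x => -[|[|[|//]]] lt_x ->.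
Qed.

Lemma node_prod f :
  node f = emb (inord 0) (f (inord 0)) * emb (inord 1) (f (inord 1))
           * emb (inord 2) (f (inord 2)).
Proof.
rewrite !nodeM; apply: eq_node; apply: letter_ind;
by rewrite -!val_eqE /= !inordK //= !gsimp.
Qed.

(** * Rotations of the first level *)

Notation a := aut_a.
Notation t := aut_t.
Notation G := GammaBB.
Notation K := (derived_subgroup GammaBB).

Lemma bar_neq x : (bar x == x) = false.
Proof. by case: x => -[|[|[|//]]] lt_x; rewrite -val_eqE. Qed.

Lemma bar_inj : injective bar.
Proof. by move=> x y e; rewrite -(bar3 x) e bar3. Qed.

Lemma iter_bar_inj i : injective (iter i bar).
Proof. by elim: i => //= i IH x y /bar_inj /IH. Qed.

Lemma bar_cases x y : [\/ y = x, y = bar x | y = bar (bar x)].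
Proof.
case: x y => [[|[|[|//]]] lx] [[|[|[|//]]] ly];
by [constructor 1; apply: val_inj | constructor 2; apply: val_inj
   | constructor 3; apply: val_inj].
Qed.

Lemma bar2_neq x : (bar (bar x) == x) = false.
Proof. by case: x => -[|[|[|//]]] lt_x; rewrite -val_eqE. Qed.

Lemma neq_bar x : (x == bar x) = false.
Proof. by rewrite eq_sym bar_neq. Qed.

Lemma neq_bar2 x : (x == bar (bar x)) = false.
Proof. by rewrite eq_sym bar2_neq. Qed.

Definition barE :=
  (bar3, inj_eq bar_inj, bar_neq, bar2_neq, neq_bar, neq_bar2, eqxx).

Lemma bar_trans x y : exists i, iter i bar x = y.
Proof.
by case: (bar_cases x y) => ->; [exists 0%N | exists 1%N | exists 2].
Qed.

Lemma a3 : a ^+ 3 = 1.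
Proof. by apply: tree_autP => w; apply: a_fun3. Qed.

Lemma t3 : t ^+ 3 = 1.
Proof. by apply: tree_autP => w; apply: t_fun3. Qed.

Lemma a_exp_cons x w i : (a ^+ i) (x :: w) = iter i bar x :: w.
Proof. by elim: i => [|i IH] //; rewrite expgS /= IH. Qed.

(** Conjugation by [a] permutes the three sections cyclically. *)
Lemma nodeJ_a_exp f i : node f ^ (a ^+ i) = node (f \o iter i bar).
Proof.
elim: i => [|i IH]; first by rewrite expg0 conjg1; apply: eq_node.
rewrite expgSr conjgM IH; apply: tree_autP => -[|x w] //=.
by rewrite bar3 -iterSr.
Qed.

Lemma embJ_a_exp x k i : emb (iter i bar x) k ^ (a ^+ i) = emb x k.
Proof.
rewrite nodeJ_a_exp; apply: eq_node => z /=.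
by rewrite (inj_eq (@iter_bar_inj i)).
Qed.

Definition t_section (x : letter) : tree_aut :=
  match val x with 0 => a | 1 => a^-1 | _ => t end.

Lemma t_node : t = node t_section.
Proof.
apply: tree_autP => -[|[[|[|[|//]]] lt_x] w] //.
- by case: w => [|y w].
- by case: w => [|y w].
Qed.

(** * Generators of the group *)

Lemma G_subgroup : is_subgroup G. Proof. exact: gen_subgroup. Qed.
Lemma G_a : G a. Proof. by apply: sub_gen_smallest; left. Qed.
Lemma G_t : G t. Proof. by apply: sub_gen_smallest; right. Qed.

Lemma G_a_exp i : G (a ^+ i). Proof. exact: subgX G_subgroup G_a. Qed.

Lemma K_normal : is_normal K G. Proof. exact: derived_normal G_subgroup. Qed.
Lemma K_subgroup : is_subgroup K. Proof. by case: K_normal. Qed.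
Lemma K_sub_G k : K k -> G k. Proof. by case: K_normal => _ s _; apply: s. Qed.
Lemma K_normalized : normalized G K. Proof. by case: K_normal. Qed.

(** Inverses of the generators need no separate case, as both have order
    three. The proof shows that left multiplication by an element of [G]
    neither creates nor destroys [P], a condition that defines a subgroup. *)
Lemma G_ind (P : tree_aut -> Prop) :
    P 1 -> (forall g, G g -> P g -> P (a * g)) ->
    (forall g, G g -> P g -> P (t * g)) ->
  forall g, G g -> P g.
Proof.
move=> P1 Pa Pt g Gg.
suff : [set g | G g /\ forall h, G h -> P h <-> P (g * h)] g.
  by case=> _ /(_ 1 (subg1 G_subgroup)) [+ _]; rewrite mulg1; apply.
have cyc s : s ^+ 3 = 1 -> G s -> (forall h, G h -> P h -> P (s * h)) ->
    forall h, G h -> P h <-> P (s * h).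
  move=> s3 Hs Ps h Gh; split=> [|Psh]; first exact: Ps.
  rewrite -[h]mul1g -s3 !expgS expg0 mulg1 -!mulgA.
  by do 2!(apply: (Ps); first by do ?apply: (subgM G_subgroup)).
apply: Gg; split; last first.
  by move=> _ [->|->]; split; try apply: cyc;
    auto using a3, t3, G_a, G_t.
apply/subgroupP; split=> [|x y [Gx Px] [Gy Py]|x [Gx Px]].
- by split=> [|h]; [exact: subg1 G_subgroup | rewrite mul1g].
- split=> [|h Gh]; first exact: subgM G_subgroup _ _.
  by rewrite (Py h Gh) -mulgA; apply: Px; apply: subgM G_subgroup _ _.
- have Gx' := subgV G_subgroup Gx; split=> // h Gh.
  by rewrite (Px (x^-1 * h)) ?mulVKg //; apply: subgM G_subgroup _ _.
Qed.

Lemma G_t_section x : G (t_section x).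
Proof.
rewrite /t_section; case: (val x) => [|[|_]];
  [exact: G_a | exact: subgV G_subgroup G_a | exact: G_t].
Qed.

(** Pushing [t] to the right of a power of [a] only rotates its sections. *)
Lemma G_decomp g : G g ->
  exists i f, [/\ i < 3, forall x, G (f x) & g = a ^+ i * node f].
Proof.
move=> Gg; suff [i [f [Gf ->]]] :
    exists i f, (forall x, G (f x)) /\ g = a ^+ i * node f.
  exists (i %% 3), f; split=> //; first by rewrite ltn_mod.
  by rewrite -expg_mod3 // a3.
elim/G_ind: g / Gg => [|_ _ [i [f [Gf ->]]]|_ _ [i [f [Gf ->]]]].
- exists 0, (fun=> 1); split=> [_|]; first exact: subg1 G_subgroup.
  by rewrite node1 expg0 mulg1.
- by exists i.+1, f; rewrite expgS mulgA.
- exists i, (fun x => t_section (iter i bar x) * f x); split=> [x|].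
    exact: subgM G_subgroup (G_t_section _) (Gf x).
  by rewrite mulgA (conjgC t) -mulgA {1}t_node nodeJ_a_exp nodeM.
Qed.

Lemma G_rot_t i : G (node (t_section \o iter i bar)).
Proof.
by rewrite -nodeJ_a_exp -t_node; apply: subgJ G_subgroup G_t (G_a_exp i).
Qed.

(** Self-replication: the sections of [t] and of its conjugates by powers of [a]
    put both generators at every first-level vertex. *)
Lemma G_section x g : G g -> exists2 f, G (node f) & f x = g.
Proof.
have lift y h : (exists2 f, G (node f) & f x = h) ->
    exists2 f, G (node f) & f x = t_section y * h.
  have [i <-] := bar_trans x y => -[f Gf <-].
  exists (fun z => t_section (iter i bar z) * f z) => //.
  by rewrite -nodeM; apply: subgM G_subgroup (G_rot_t i) Gf.
elim/G_ind => [|h _ /(lift ord0)//|h _ /(lift ord_max)//].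
by exists (fun=> 1); rewrite ?node1; try exact: subg1 G_subgroup.
Qed.

(** * Branching over the commutator subgroup *)

(** The sections of [t * t ^ a], rotated so that the trivial one is at [y]. *)
Definition branch_node (y : letter) : letter -> tree_aut :=
  fun z => if z == y then 1 else if z == bar y then a^-1 * t else t * a.

Lemma G_branch_node y : G (node (branch_node y)).
Proof.
have [i yi] := bar_trans y ord0.
have -> : branch_node y = branch_node ord0 \o iter i bar.
  apply: funext => z; rewrite /branch_node /= -yi -iterS iterSr.
  by rewrite !(inj_eq (@iter_bar_inj i)).
rewrite -nodeJ_a_exp; apply: subgJ G_subgroup _ (G_a_exp i).
suff -> : node (branch_node ord0) = t * t ^ a.
  exact: subgM G_subgroup G_t (subgJ G_subgroup G_t G_a).
rewrite t_node -[a]expg1 nodeJ_a_exp nodeM; apply: eq_node.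
by case=> -[|[|[|//]]] lt_x;
  rewrite /branch_node /t_section -!val_eqE /= ?mulgV.
Qed.

(** The product [(t a) (a^-1 t)] is [t ^+ 2], which recovers [t], then [a]. *)
Lemma G_gen_branch : G = generated [set a^-1 * t; t * a].
Proof.
apply/seteqP; split; apply: smallest_sub; try exact: gen_subgroup.
- set H := generated _; have Hs : is_subgroup H by apply: gen_subgroup.
  have Hu : H (a^-1 * t) by apply: sub_gen_smallest; left.
  have Hv : H (t * a) by apply: sub_gen_smallest; right.
  have Ht : H t.
    have -> : t = (t * a * (a^-1 * t))^-1.
      apply/esym/mulg1_eq; by rewrite -!mulgA mulVKg -[RHS]t3.
    by apply: (subgV Hs); apply: (subgM Hs).
  move=> _ [->|->] //; rewrite -[a](mulKg t).
  by apply: (subgM Hs) => //; apply: (subgV Hs).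
- move=> _ [->|->]; apply: subgM G_subgroup _ _; try exact: G_t; last exact: G_a.
  exact: subgV G_subgroup G_a.
Qed.

Definition section_group (M : set tree_aut) x : set tree_aut :=
  [set k | M (emb x k)].

(** A conjugating element [g] can be lifted, by self-replication, to an element
    of [G] whose section at [x] is [g]. *)
Lemma section_group_normalized M x :
  normalized G M -> normalized G (section_group M x).
Proof.
case=> Ms MJ; split.
  apply/subgroupP; split=> [|k l Mk Ml|k Mk]; rewrite /section_group /=.
  - by rewrite emb1; apply: subg1.
  - by rewrite embM; apply: subgM.
  - by rewrite embV; apply: subgV.
move=> k g Mk Gg; have [f Gf <-] := G_section x Gg.
by rewrite /section_group /= -embJ; apply: MJ.
Qed.

(** The powers of [a] permute the letters transitively. *)
Lemma section_group_eq M x y k :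
  normalized G M -> section_group M x k -> section_group M y k.
Proof.
case=> _ MJ; rewrite /section_group /=; have [i <-] := bar_trans y x => Mk.
by rewrite -(embJ_a_exp y k i); apply: MJ (G_a_exp i).
Qed.

Lemma node_in M f :
  is_subgroup M -> (forall x, M (emb x (f x))) -> M (node f).
Proof. by move=> Ms Mf; rewrite node_prod; do 2?apply: subgM. Qed.

(** The non-trivial sections of two distinct rotations of [t * t ^ a] overlap at
    one letter only, where their commutator is that of two generators. *)
Lemma K_branching x k : K k -> K (emb x k).
Proof.
suff KK : K `<=` section_group K x by apply: KK.
have nK := section_group_normalized x K_normalized.
apply: derived_sub nK.1 _.
have := @comm_mod_of_gens _ (a^-1 * t) (t * a) (section_group K x).
rewrite -G_gen_branch; apply=> //.
rewrite -invgR; apply: subgV nK.1 _; rewrite /section_group /=.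
suff -> : emb x [~ t * a, a^-1 * t] =
    [~ node (branch_node (bar x)), node (branch_node (bar (bar x)))].
  by apply: comm_derived; apply: G_branch_node.
rewrite nodeR; apply: eq_node => z; rewrite /branch_node bar3.
by case: (bar_cases x z) => ->; rewrite !barE ?comm1g ?commg1.
Qed.

(** * Finite index *)

(** The representatives [r j] may lie outside [G], and [M] need not be contained
    in [G]; this flexibility lets finite index pass from groups of sections
    to the group itself. *)
Definition finite_index (M : set tree_aut) : Prop :=
  exists (T : finType) (r : T -> tree_aut),
    forall g, G g -> exists j, M ((r j)^-1 * g).

Lemma finite_index_cosets M :
  is_subgroup M -> finite_index M -> finite_set (left_cosets G M).
Proof.
move=> Ms [T [r r_cover]].
apply: (@sub_finite_set _ _ ((fun j => [set r j * y | y in M]) @` setT)).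
  move=> _ [g Gg <-]; have [j Mj] := r_cover g Gg; exists j => //.
  apply/seteqP; split=> _ [y My <-].
    exists (((r j)^-1 * g)^-1 * y); last by rewrite invgM invgK mulgA mulVKg.
    by apply: subgM => //; apply: subgV.
  by exists ((r j)^-1 * g * y); [exact: subgM | rewrite !mulgA mulgV mul1g].
by apply: finite_image; apply: finite_finset.
Qed.

(** Reduce an element [a ^+ i * node f] by choosing a representative for each of
    the three sections: what remains is a product of copies of elements of the
    section groups, all of which are equal. *)
Lemma finite_index_section M x :
  normalized G M -> finite_index (section_group M x) -> finite_index M.
Proof.
move=> nM [T [r r_cover]].
exists ('I_3 * {ffun letter -> T})%type,
  (fun q : 'I_3 * {ffun letter -> T} =>
    a ^+ val q.1 * node (fun z => r (q.2 z))).
move=> _ /G_decomp[i [f [lt_i Gf ->]]].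
have [q Mq] := choice (fun z => r_cover (f z) (Gf z)).
exists (Ordinal lt_i, [ffun z => q z]).
rewrite /= invgM -mulgA mulKg nodeV nodeM; apply: node_in nM.1 _ => z.
by rewrite ffunE; apply: section_group_eq nM (Mq z).
Qed.

(** Modulo [M], [G] is nilpotent of class at most two: the commutator [d] of
    [t] and [a] is central, and [d ^+ 3] is trivial, being the commutator of [t]
    and [a ^+ 3]. So each element has a normal form [a ^+ i * t ^+ j * d ^+ l]
    with exponents below three. *)
Lemma finite_index_central M :
    normalized G M -> (forall k g, K k -> G g -> M [~ k, g]) ->
  finite_index M.
Proof.
move=> [Ms MJ] Kcent; pose d := [~ t, a].
have Kd : K d by apply: comm_derived; [exact: G_t | exact: G_a].
(* Modulo [M], commuting with [t] turns powers of [a] into powers of [d]. *)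
have comm_ta i : exists2 m, M m & [~ t, a ^+ i] = d ^+ i * m.
  elim: i => [|i [m Mm IH]].
    by exists 1; [exact: subg1 | rewrite expg0 commg1 mulg1].
  exists (m ^ d * [~ d, a ^+ i]).
    apply: subgM => //; last exact: Kcent (G_a_exp i).
    by apply: MJ => //; apply: K_sub_G.
  have -> : [~ t, a ^+ i.+1] = [~ t, a ^+ i] * d ^ a ^+ i.
    by rewrite expgS /d /commg /conjg !gnorm.
  by rewrite IH expgSr /commg /conjg !gnorm.
have d3 : M (d ^+ 3).
  have [m Mm] := comm_ta 3; rewrite a3 commg1 => /esym/mulg1_eq e.
  by rewrite -[_ ^+ 3]invgK e; apply: subgV.
have normal_form g : G g ->
    exists i j l m, M m /\ g = a ^+ i * t ^+ j * d ^+ l * m.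
  elim/G_ind: g / => [|_ _ [i [j [l [m [Mm ->]]]]]|_ _ [i [j [l [m [Mm ->]]]]]].
  - by exists 0%N, 0%N, 0%N, 1; rewrite !expg0 !mulg1; split=> //; apply: subg1.
  - by exists i.+1, j, l, m; rewrite expgS !mulgA.
  (* Moving [t] past [a ^+ i] creates [c], which is [d ^+ i] modulo [M] and
     central modulo [M]; it is carried past [t ^+ j * d ^+ l]. *)
  have [m1 Mm1 e1] := comm_ta i; pose c := [~ t, a ^+ i].
  have Kc : K c by apply: comm_derived; [exact: G_t | exact: G_a_exp].
  have Gtd : G (t ^+ j * d ^+ l).
    apply: subgM G_subgroup (subgX _ G_subgroup G_t) _.
    exact: subgX G_subgroup (K_sub_G Kd).
  exists i, j.+1, (l + i)%N, (m1 * [~ c, t ^+ j * d ^+ l] * m); split.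
    exact: subgM Ms (subgM Ms Mm1 (Kcent _ _ Kc Gtd)) Mm.
  have -> : m1 = d ^- i * c by rewrite /c e1 mulKg.
  rewrite expgnDr expgS !mulgA (commgC t) -/c mulgK.
  by rewrite -(mulgA _ c) -(mulgA _ (c * _)) -(mulgA c) (commgC c) !mulgA.
exists ('I_3 * 'I_3 * 'I_3)%type,
  (fun q : 'I_3 * 'I_3 * 'I_3 => a ^+ q.1.1 * t ^+ q.1.2 * d ^+ q.2).
move=> g /normal_form[i [j [l [m [Mm ->]]]]].
exists (inord (i %% 3), inord (j %% 3), inord (l %% 3)).
rewrite /= !inordK ?ltn_mod // -(@expg_mod3 _ a) ?a3 // -(@expg_mod3 _ t) ?t3 //.
have -> : d ^+ l = d ^+ (l %% 3) * (d ^+ 3) ^+ (l %/ 3).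
  by rewrite -expgnA -expgnDr addnC mulnC -divn_eq.
rewrite (mulgA (_ * t ^+ j)) -(mulgA _ _ m) mulKg.
by apply: subgM => //; apply: subgX.
Qed.

(** * Normal subgroups *)

Lemma section_group_comm M x f k :
  normalized G M -> M (node k) -> G (node f) ->
  (forall z, z != x -> k z = 1 \/ f z = 1) -> section_group M x [~ k x, f x].
Proof.
move=> [Ms MJ] Mk Gf kf1; rewrite /section_group /=.
have -> : emb x [~ k x, f x] = [~ node k, node f].
  rewrite nodeR; apply: eq_node => z; case: eqP => [->|/eqP/kf1[]->] //.
    by rewrite comm1g.
  by rewrite commg1.
by apply: subgM => //; [apply: subgV | apply: MJ].
Qed.

(** Each of the two sections is isolated by commuting with the rotation of
    [t * t ^ a] that is trivial at the other letter. That rotation has section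
    [a^-1 * t] at [x] in the first case and [t * a] at [y] in the second, so that
    together the section group contains the commutators of [K] with both of
    two generators of [G]. *)
Lemma finite_index_two_sections M x y :
    normalized G M -> x = bar y ->
    (forall k, K k -> exists k', M (emb x k * emb y k')) ->
    (forall k, K k -> exists k', M (emb x k' * emb y k)) ->
  finite_index M.
Proof.
move=> nM xy Mx My; apply: (@finite_index_section M x) => //.
have nMx := section_group_normalized x nM.
apply: finite_index_central => // k g Kk Gg.
rewrite -invgR; apply: (subgV nMx.1).
have sym h h' : section_group M x [~ h, h'] -> section_group M x [~ h', h].
  by move=> ?; rewrite -invgR; apply: subgV nMx.1 _.
have := @comm_mod_gens_left _ (a^-1 * t) (t * a) (section_group M x) k.
rewrite -G_gen_branch; apply=> //; apply: sym.
- have [k' Mk] := Mx k Kk; rewrite /emb nodeM in Mk.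
  have := section_group_comm (x := x) nM Mk (G_branch_node y).
  rewrite /branch_node xy !barE mulg1; apply=> z.
  by case: (bar_cases y z) => ->; rewrite !barE ?mulg1; auto.
- have [k' Mk] := My k Kk; rewrite /emb nodeM in Mk.
  apply: (@section_group_eq M y) => //.
  have := section_group_comm (x := y) nM Mk (G_branch_node x).
  rewrite /branch_node xy !barE mul1g; apply=> z.
  by case: (bar_cases y z) => ->; rewrite !barE ?mulg1; auto.
Qed.

Lemma emb_comm x y k l : x != y -> emb x k * emb y l = emb y l * emb x k.
Proof.
move=> /eqP xy; rewrite !nodeM; apply: eq_node => z.
by case: (z =P x) => [->|_]; case: eqP => // _; rewrite !gsimp.
Qed.

(** An element [g] that rotates the first level carries [emb x k] to another
    letter [y]; the commutator of the two thus has the section [k] at [x] and a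
    conjugate of [k^-1] at [y], and either of them can be prescribed. *)
Lemma finite_index_of_moved_level1 M i f :
    normalized G M -> 0 < i < 3 -> (forall z, G (f z)) ->
    (forall k, K k -> M [~ a ^+ i * node f, k]) ->
  finite_index M.
Proof.
move=> nM /andP[i_gt0 i_lt3] Gf MgK.
pose y := ord0 : letter; pose x := iter i bar y.
have Mpair k : K k -> M (emb y (k^-1 ^ f y) * emb x k).
  move=> Kk; rewrite -embJ -(embJ_a_exp _ _ i) -conjgM embV.
  have := MgK _ (K_branching x Kk); congr M.
  by rewrite /commg /conjg !gnorm.
have Mpair' k : K k -> M (emb y k * emb x (k ^ (f y)^-1)^-1).
  move=> Kk; have := @Mpair (k ^ (f y)^-1)^-1; rewrite invgK conjgKV; apply.
  apply: (subgV K_subgroup); apply: (K_normalized.2 _ _ Kk).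
  exact: subgV G_subgroup _.
have xy : x != y.
  by rewrite /x; case: i i_gt0 i_lt3 {x MgK Mpair Mpair'} => [|[|[|]]].
have [x_bar|y_bar] : x = bar y \/ y = bar x.
- by rewrite /x; case: i i_gt0 i_lt3 {x xy MgK Mpair Mpair'} => [|[|[|]]] //= _ _;
    [left | right; rewrite bar3].
- apply: (@finite_index_two_sections M x y) => // k Kk.
    by exists (k^-1 ^ f y); rewrite emb_comm //; apply: Mpair.
  by exists (k ^ (f y)^-1)^-1; rewrite emb_comm //; apply: Mpair'.
- apply: (@finite_index_two_sections M y x) => // k Kk.
    by exists (k ^ (f y)^-1)^-1; apply: Mpair'.
  by exists (k^-1 ^ f y); apply: Mpair.
Qed.

(** Asking only that [M] contain the commutators of [g] with [K], rather than
    [g] itself, is what lets the induction pass to sections: by branching,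
    [K] contains the copies of its elements, whereas a copy of a section of [g]
    need not belong to [M]. *)
Lemma finite_index_of_moved_word w M g :
    normalized G M -> G g -> g w <> w -> (forall k, K k -> M [~ g, k]) ->
  finite_index M.
Proof.
elim: w M g => [|x w IH] M g nM Gg.
  by case; exact: aut_nil.
have [i [f [i_lt3 Gf ->]]] := G_decomp Gg.
have [->|i_gt0] := posnP i; last first.
  by move=> _; apply: finite_index_of_moved_level1; rewrite ?i_gt0.
rewrite expg0 mul1g /= => fw MfK; apply: (@finite_index_section M x) => //.
apply: (IH _ (f x)) => // [||k Kk]; first exact: section_group_normalized.
  by move=> e; rewrite e in fw.
by rewrite /section_group /= -comm_node_emb; apply: MfK; apply: K_branching.
Qed.

Lemma normal_finite_index N :
  is_normal N G -> N <> [set 1] -> finite_set (left_cosets G N).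
Proof.
move=> [Ns NG NJ] N1; apply: finite_index_cosets => //.
have [g Ng g1] : exists2 g, N g & g <> 1.
  apply: contrapT => no_g; apply: N1; apply/seteqP; split=> [g Ng|_ ->].
    by apply: contrapT => g1; apply: no_g; exists g.
  exact: subg1.
have [w gw] : exists w, g w <> w.
  apply: contrapT => no_w; apply: g1; apply: tree_autP => w.
  by apply: contrapT => gw; apply: no_w; exists w.
apply: (finite_index_of_moved_word _ (NG _ Ng) gw) => // k /K_sub_G Gk.
by apply: subgM => //; [apply: subgV | apply: NJ].
Qed.

(** * Fractality and infinity *)

Lemma G_restr s g : G g -> G (restr s g).
Proof.
elim: s g => [|x s IH] g Gg; first by rewrite restr_nil.
have [i [f [_ Gf ->]]] := G_decomp Gg.
have -> : restr (x :: s) (a ^+ i * node f) = restr s (f x).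
  by apply: tree_autP => w; rewrite /= a_exp_cons.
exact: IH.
Qed.

Lemma G_fractal : fractal G.
Proof.
move=> s; apply/seteqP; split=> [_ [g [Gg _] <-]|]; first exact: G_restr.
elim: s => [|x s IH] h Gh.
  by exists h; rewrite ?restr_nil //; split=> //; exact: aut_nil.
have [g [Gg gs] gh] := IH h Gh; have [f Gf fx] := G_section x Gg.
exists (node f); last by rewrite restr_node fx.
by split=> //=; rewrite fx gs.
Qed.

(** Were [G] finite, its proper subset fixing the vertex [0] could not be mapped
    onto [G] by taking sections. *)
Lemma G_infinite : infinite_set G.
Proof.
move=> /finite_seqP[s0 Gs0].
pose s := undup s0; have sG g : g \in s <-> G g by rewrite mem_undup Gs0.
pose fix0 (g : tree_aut) := g [:: ord0] == [:: ord0].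
pose s1 := filter fix0 s.
have : size s <= size s1.
  rewrite -(size_map (restr [:: ord0])); apply: uniq_leq_size (undup_uniq _) _.
  move=> h /sG; rewrite -{1}(G_fractal [:: ord0]) => -[g [Gg g0] <-].
  by apply: map_f; rewrite mem_filter /fix0 g0 eqxx; apply/sG.
rewrite leqNgt size_filter -(count_predC fix0 s).
rewrite -[X in X < _]addn0 ltn_add2l -has_count => /negP; apply.
by apply/hasP; exists a => //; apply/sG; apply: G_a.
Qed.

(** [G] acts on the first level through powers of a single cycle, which
    commute. *)
Lemma K_level1 : K `<=` level_stab G 1.
Proof.
move=> k Kk w /= w1; split; first exact: K_sub_G.
case: w w1 => [|x []] // _.
suff : K `<=` [set g : tree_aut | g [:: x] = [:: x]] by apply.
apply: derived_sub => [|g h Gg Gh].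
  apply/subgroupP; split=> //= [g h gx hx|g gx]; first by rewrite hx.
  by rewrite -{1}gx aut_funK.
have [i [f [_ _ ->]]] := G_decomp Gg; have [j [f' [_ _ ->]]] := G_decomp Gh.
set g1 := _ * node f; set h1 := _ * node f'.
have -> : [~ g1, h1] = (h1 * g1)^-1 * (g1 * h1).
  by rewrite /commg /conjg !gnorm.
have e : (g1 * h1) [:: x] = (h1 * g1) [:: x].
  by rewrite /= !a_exp_cons !aut_nil -!iterD addnC.
by change (aut_inv (h1 * g1) ((g1 * h1) [:: x]) = [:: x]); rewrite e aut_funK.
Qed.

Lemma K3_sub_phi_K : K `*` K `*` K `<=` phi @` K.
Proof.
move=> [[k0 k1] k2] [[/= Kk0 Kk1] Kk2].
pose f (z : letter) := nth 1 [:: k0; k1; k2] z.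
exists (node f); last first.
  by rewrite /phi !restr_node !restr_nil /f !inordK.
by apply: node_in K_subgroup _; apply: letter_ind; apply: K_branching;
  rewrite /f inordK.
Qed.

Theorem proposition8p3 :
  just_infinite GammaBB /\ fractal GammaBB /\
  regular_branch_over GammaBB (derived_subgroup GammaBB).
Proof.
split; first by split; [exact: G_infinite | exact: normal_finite_index].
split; first exact: G_fractal.
split; [exact: K_normal | exact: K_level1 | | exact: K3_sub_phi_K].
apply: finite_index_cosets K_subgroup _.
apply: finite_index_central K_normalized _.
by move=> k g /K_sub_G Gk Gg; apply: comm_derived.
Qed.
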